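(* Let $f(\mathbf{x})=\mathbf{x}^{T}A\mathbf{x}+b^{T}\mathbf{x}+1$ with $A\in\mathbb{R}^{n\times n}$ symmetric and $b\in\mathbb{R}^n$. Then $f$ admits a monic Hermitian determinantal representation of some size, i.e. $f(\mathbf{x})=\det(I_k+x_1A_1+\dots+x_nA_n)$ for some $k\ge1$ and Hermitian $A_j\in\mathbb{C}^{k\times k}$, if and only if at least one of the following holds: (1) $A$ is negative semidefinite; (2) $A-\frac14 bb^{T}$ is negative semidefinite and $\operatorname{rank}(A-\frac14bb^T)\le 3$. Moreover, if $A$ is not negative semidefinite and $f$ has such a representation of some size, then $f$ has one of size $2$. *)

(* Defs.v *)
(* The real numbers R are represented as the real elements
   (Num.real) of an arbitrary numerically closed field C (for instance C = the
   complex numbers); "real matrix" = matrix over C with real entries. *)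
From HB Require Import structures.
From mathcomp Require Import all_boot all_order all_algebra.
Set Implicit Arguments. Unset Strict Implicit. Unset Printing Implicit Defensive.
Import Order.TTheory GRing.Theory Num.Theory.
Local Open Scope ring_scope.

Section Defs.
Context {C : numClosedFieldType}.

Definition quadf {n} (A : 'M[C]_n) (b : 'cV[C]_n) (x : 'cV[C]_n) : C :=
  (x^T *m A *m x) 0 0 + (b^T *m x) 0 0 + 1.

Definition hermitian {k} (M : 'M[C]_k) : Prop := M^T = map_mx Num.conj M.

Definition nsd {n} (M : 'M[C]_n) : Prop :=
  forall v : 'cV[C]_n, v \is a mxOver Num.real -> (v^T *m M *m v) 0 0 <= 0.

Definition has_mhdr_of_size {n} (f : 'cV[C]_n -> C) (k : nat) : Prop :=
  exists As : 'I_n -> 'M[C]_k,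
    (forall j, hermitian (As j)) /\
    (forall x : 'cV[C]_n, x \is a mxOver Num.real ->
       f x = \det (1%:M + \sum_(j < n) x j 0 *: As j)).

End Defs.

(* Main.v *)
From HB Require Import structures.
From mathcomp Require Import all_boot all_order all_algebra all_fingroup.
From mathcomp Require Import ring.
From Stdlib Require Import Classical.
Require Import Defs.
Set Implicit Arguments. Unset Strict Implicit. Unset Printing Implicit Defensive.
Import Order.TTheory GRing.Theory Num.Theory.
Local Open Scope ring_scope.

(** Completing the square, [f = (1 + b^T x / 2)^2 - y0^2 - y1^2 - y2^2] for
    linear forms [y0], [y1], [y2] under (2), and this is the determinant of the matrix
    [[1 + b^T x / 2 + y0, y1 + i y2], [y1 - i y2, 1 + b^T x / 2 - y0]].

    The converse rests on a reduction of the pencil [M] to size 2.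
    If [x0^T A x0 > 0], then [det (1 + t M(x0))] is quadratic in [t] with
    positive leading coefficient, so in a suitable orthonormal basis
    [M(x0) = diag (d0, d1, 0, ..., 0)] with [d0 d1 > 0]. Split [M(x)] into
    blocks [[P, Q], [Q', R]] accordingly, [Q'] being the adjoint of [Q].
    The coefficient of [t^2] in [det (1 + t M(x0) + M(x))] gives
    [det (1 + R(x)) = 1] for all real [x], hence [R = 0]; then
    [f = det (1 + P - Q Q')], and the absence of terms of degree 3 gives
    [d0 |Q_1|^2 + d1 |Q_0|^2 = 0] for the rows of [Q], hence [Q = 0].
    So [f = det (1 + P)] with [P] of size 2, which exhibits
    [b b^T / 4 - A] as a sum of three squares. *)

(** * Bilinear forms; block and small determinants *)

Section BilinearForm.
Variables (R : comNzRingType) (n : nat).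
Implicit Types (S : 'M[R]_n) (u v : 'cV[R]_n).

Definition bform S u v : R := (u^T *m S *m v) 0 0.

Lemma bformDl S u1 u2 v : bform S (u1 + u2) v = bform S u1 v + bform S u2 v.
Proof. by rewrite /bform linearD !mulmxDl mxE. Qed.

Lemma bformDr S u v1 v2 : bform S u (v1 + v2) = bform S u v1 + bform S u v2.
Proof. by rewrite /bform mulmxDr mxE. Qed.

Lemma bformZl S a u v : bform S (a *: u) v = a * bform S u v.
Proof. by rewrite /bform linearZ /= -!scalemxAl mxE. Qed.

Lemma bformZr S a u v : bform S u (a *: v) = a * bform S u v.
Proof. by rewrite /bform -!scalemxAr mxE. Qed.

Lemma bform_sym S u v : S^T = S -> bform S u v = bform S v u.
Proof.
move=> hS; rewrite /bform; transitivity ((v^T *m S *m u)^T 0 0); last by rewrite mxE.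
by rewrite !trmx_mul trmxK hS mulmxA.
Qed.

Lemma bform_row S i v : bform S (delta_mx i 0) v = (row i S *m v) 0 0.
Proof. by rewrite /bform trmx_delta -rowE. Qed.

Lemma bform_delta S i j : bform S (delta_mx i 0) (delta_mx j 0) = S i j.
Proof. by rewrite bform_row -colE !mxE. Qed.

Lemma bformB S T u v : bform (S - T) u v = bform S u v - bform T u v.
Proof. by rewrite /bform mulmxBr mulmxBl !mxE. Qed.

Lemma bformN S u v : bform (- S) u v = - bform S u v.
Proof. by rewrite /bform mulmxN mulNmx mxE. Qed.

Lemma bformZ a S u v : bform (a *: S) u v = a * bform S u v.
Proof. by rewrite /bform -scalemxAr -scalemxAl mxE. Qed.

Lemma bform_outer (w v : 'cV[R]_n) : bform (w *m w^T) v v = (w^T *m v) 0 0 ^+ 2.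
Proof.
rewrite /bform mulmxA -mulmxA mxE big_ord1 expr2; congr (_ * _).
by transitivity ((w^T *m v)^T 0 0); [rewrite trmx_mul trmxK | rewrite mxE].
Qed.

Lemma bform_gram m (B : 'M[R]_(m, n)) v :
  bform (B^T *m B) v v = ((B *m v)^T *m (B *m v)) 0 0.
Proof. by rewrite /bform trmx_mul !mulmxA. Qed.

End BilinearForm.

Lemma det_schur (R : comPzRingType) m n (E : 'M[R]_m) (Q : 'M[R]_(m, n)) (Q' : 'M[R]_(n, m)) :
  \det (block_mx E Q Q' 1%:M) = \det (E - Q *m Q').
Proof.
have -> : block_mx E Q Q' 1%:M =
   block_mx 1%:M Q 0 1%:M *m block_mx (E - Q *m Q') 0 Q' 1%:M.
  by rewrite mulmx_block !(mul0mx, mul1mx, mulmx0, mulmx1, addr0, add0r) subrK.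
by rewrite det_mulmx det_ublock det_lblock !det1 !mul1r mulr1.
Qed.

Lemma det_mx2 (R : comNzRingType) (M : 'M[R]_2) :
  \det M = M 0 0 * M 1 1 - M 0 1 * M 1 0.
Proof.
rewrite (expand_det_row _ 0) !big_ord_recl big_ord0 /cofactor !det_mx11 !mxE /=.
have -> : lift (0 : 'I_2) 0 = 1 by apply/val_inj.
have -> : lift (1 : 'I_2) 0 = 0 by apply/val_inj.
by rewrite /=; ring.
Qed.

Lemma det1D_mx2 (R : comNzRingType) (M : 'M[R]_2) :
  \det (1%:M + M) = (1 + M 0 0) * (1 + M 1 1) - M 0 1 * M 1 0.
Proof. by rewrite det_mx2 !mxE /= !mulr1n !mulr0n !add0r. Qed.

Lemma dot3 (R : comNzRingType) (v w : 'cV[R]_3) :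
  (v^T *m w) 0 0 = v 0 0 * w 0 0 + v 1 0 * w 1 0 + v 2%:R 0 * w 2%:R 0.
Proof.
rewrite mxE !big_ord_recl big_ord0 !mxE addr0 addrA.
have -> : lift (0 : 'I_3) (lift (0 : 'I_2) 0) = 2%:R by apply/val_inj.
by have -> : lift (0 : 'I_3) 0 = 1 by apply/val_inj.
Qed.

(** * Real symmetric forms and Gram factorization with few rows *)

Section RealForms.
Variable C : numClosedFieldType.
Notation realmx := (mxOver (@Num.real C)).

Lemma trmx_real m n (M : 'M[C]_(m, n)) : M \is a realmx -> M^T \is a realmx.
Proof. by move/mxOverP=> h; apply/mxOverP => i j; rewrite mxE h. Qed.

Lemma oppmx_real m n (M : 'M[C]_(m, n)) : M \is a realmx -> - M \is a realmx.
Proof. by move/mxOverP=> h; apply/mxOverP => i j; rewrite mxE rpredN h. Qed.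

Lemma bform_real n (S : 'M[C]_n) u v : S \is a realmx -> u \is a realmx ->
  v \is a realmx -> bform S u v \is Num.real.
Proof.
move=> hS hu hv; have /mxOverP H : u^T *m S *m v \is a realmx.
  by rewrite !mxOverM // trmx_real.
exact: H.
Qed.

Lemma delta_mx_real m n i j : (delta_mx i j : 'M[C]_(m, n)) \is a realmx.
Proof. by apply/mxOverP => k l; rewrite mxE realn. Qed.

(** Polarization: evaluating at a sum of two basis vectors isolates twice an entry. *)
Lemma sym_bform_inj n (S T : 'M[C]_n) : S^T = S -> T^T = T ->
  (forall v, v \is a realmx -> bform S v v = bform T v v) -> S = T.
Proof.
move=> hS hT H; apply/matrixP => i j; have hd := delta_mx_real.
have := H _ (realmxD (hd n 1%N i 0) (hd n 1%N j 0)).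
rewrite !bformDl !bformDr !H // (bform_sym (delta_mx j 0) (delta_mx i 0) hS).
rewrite (bform_sym (delta_mx j 0) (delta_mx i 0) hT) !bform_delta.
move=> /eqP; rewrite -subr_eq0 => E; apply/eqP; rewrite -subr_eq0.
have : (S i j - T i j) *+ 2 == 0 by apply: etrans E; congr (_ == _); ring.
by rewrite mulrn_eq0.
Qed.

(** With zero diagonal, the form at [e_i - S i j *: e_j] equals [-2 * S i j ^+ 2], which
    nonnegativity forces to vanish. *)
Lemma psd_diag0 n (S : 'M[C]_n) : S \is a realmx -> S^T = S ->
  (forall v, v \is a realmx -> 0 <= bform S v v) ->
  (forall i, S i i = 0) -> S = 0.
Proof.
move=> hR hS H S0; apply/matrixP => i j; rewrite !mxE.
have Rij : S i j \is Num.real by exact: (mxOverP hR).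
have hd := delta_mx_real.
have := H (delta_mx i 0 + (- S i j) *: delta_mx j 0).
rewrite realmxD ?mxOverZ ?rpredN // => /(_ isT).
rewrite !bformDl !bformDr !bformZl !bformZr (bform_sym (delta_mx j 0) (delta_mx i 0) hS).
rewrite !bform_delta !S0 => E.
apply/eqP; rewrite -sqrf_eq0; apply/eqP/le_anti; rewrite -realEsqr Rij andbT.
have : 0 <= - (S i j ^+ 2 *+ 2) by apply: etrans E; congr (0 <= _); ring.
by rewrite oppr_ge0 pmulrn_lle0.
Qed.

(* Peel off the square of the linear form [row i S / sqrt (S i i)]; this lowers the rank by one and keeps the form positive semidefinite. *)
Lemma psd_gram n (S : 'M[C]_n) m : S \is a realmx -> S^T = S ->
  (forall v, v \is a realmx -> 0 <= bform S v v) -> (\rank S <= m)%N ->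
  exists2 B : 'M[C]_(m, n), B \is a realmx & S = B^T *m B.
Proof.
elim: m S => [|m IH] S hR hS H rk.
  exists 0; first by apply/mxOverP => i j; rewrite mxE real0.
  by rewrite mulmx0; apply/eqP; rewrite -mxrank_eq0 -leqn0.
have [/existsP[i Sii] | /existsPn S0] := boolP [exists i, S i i != 0]; last first.
  exists 0; first by apply/mxOverP => i j; rewrite mxE real0.
  rewrite mulmx0; apply: psd_diag0 => // i; exact/eqP/negPn/S0.
have hd := delta_mx_real.
have dgt0 : 0 < S i i by rewrite lt0r Sii -bform_delta H.
pose s := sqrtC (S i i).
have s2 : s ^+ 2 = S i i by rewrite sqrtCK.
have s0 : s != 0 by rewrite sqrtC_eq0.
have sR : s \is Num.real by rewrite ger0_real // sqrtC_ge0 ltW.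
pose l := s^-1 *: row i S.
have lR : l \is a realmx.
  by rewrite mxOverZ ?rpredV //; apply/mxOverP => a b; rewrite mxE (mxOverP hR).
have lv v : (l *m v) 0 0 = s^-1 * bform S (delta_mx i 0) v.
  by rewrite bform_row -scalemxAl mxE.
pose S' := S - l^T *m l.
have S'R : S' \is a realmx by rewrite /S' realmxD // oppmx_real // mxOverM // trmx_real.
have S'S : S'^T = S' by rewrite /S' linearB /= trmx_mul trmxK hS.
have S'E v : bform S' v v = bform S v v - (s^-1 * bform S (delta_mx i 0) v) ^+ 2.
  by rewrite bformB -{2}[l]trmxK bform_outer trmxK lv.
(* The row space shrinks strictly: [S'] kills the [i]-th basis vector, while [S] does not because
   [S i i] is nonzero. *)
have lS : (l <= S)%MS by rewrite scalemx_sub // row_sub.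
have S'sub : (S' < S)%MS.
  rewrite ltmxE; apply/andP; split.
    by rewrite addmx_sub // eqmx_opp mulmx_sub.
  apply/negP => /submxP[X].
  move=> /(congr1 (fun M => (M *m delta_mx i (0 : 'I_1)) i 0)).
  rewrite -mulmxA.
  have -> : S' *m delta_mx i (0 : 'I_1) = 0.
    apply/colP => k; rewrite -colE !mxE big_ord1 !mxE.
    have -> : S i k = S k i by rewrite -[in LHS]hS mxE.
    by rewrite mulrACA -invfM -expr2 s2 mulrC mulfK ?subrr.
  by rewrite mulmx0 -colE !mxE => E; rewrite E eqxx in Sii.
have [||B BR BE] := IH S' S'R S'S.
(* The scalar [- c] minimizes [S] on the line through [v] in direction [e_i], and the minimum is
   exactly [bform S' v v]. *)
- move=> v vR; set c := bform S (delta_mx i 0) v / S i i.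
  have cR : c \is Num.real by rewrite rpredM ?rpredV ?bform_real ?hd // ger0_real // ltW.
  have := H (v + (- c) *: delta_mx i 0).
  rewrite realmxD ?mxOverZ ?rpredN // => /(_ isT).
  rewrite !bformDl !bformDr !bformZl !bformZr (bform_sym v _ hS) bform_delta S'E.
  move=> E; apply: etrans E; congr (0 <= _); rewrite exprMn exprVn s2 /c; field; exact: Sii.
- by rewrite -ltnS; apply: leq_trans rk; rewrite ltmxErank in S'sub; case/andP: S'sub.
exists (col_mx l B : 'M_(1 + m, n)).
  by apply/mxOverP => a b; rewrite mxE; case: split => k; rewrite (mxOverP lR) || rewrite (mxOverP BR).
transitivity (row_mx l^T B^T *m col_mx l B); last by rewrite -tr_col_mx.
by rewrite mul_row_col -BE addrC subrK.
Qed.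
End RealForms.

(** * Linear pencils and the two explicit constructions *)

Section Representations.
Variable C : numClosedFieldType.
Notation realmx := (mxOver (@Num.real C)).

Lemma quadfE n (A : 'M[C]_n) b x :
  quadf A b x = bform A x x + (b^T *m x) 0 0 + 1.
Proof. by []. Qed.

Definition pencil n k (As : 'I_n -> 'M[C]_k) (x : 'cV[C]_n) : 'M[C]_k :=
  \sum_j x j 0 *: As j.

Lemma pencil_is_linear n k (As : 'I_n -> 'M[C]_k) : linear (pencil As).
Proof.
move=> a u v; rewrite /pencil scaler_sumr -big_split /=.
by apply: eq_bigr => j _; rewrite !mxE scalerDl scalerA.
Qed.

HB.instance Definition _ n k (As : 'I_n -> 'M[C]_k) :=
  GRing.isLinear.Build C _ _ _ (pencil As) (pencil_is_linear As).

Lemma pencil_entry n k (As : 'I_n -> 'M[C]_k) x a c :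
  pencil As x a c = \sum_j As j a c * x j 0.
Proof. by rewrite summxE; apply: eq_bigr => j _; rewrite mxE mulrC. Qed.

Lemma hermitian_entry k (M : 'M[C]_k) i j : hermitian M -> M j i = Num.conj (M i j).
Proof. by move/matrixP/(_ i j); rewrite !mxE. Qed.

Lemma hermitian_diag_real k (M : 'M[C]_k) i : hermitian M -> M i i \is Num.real.
Proof. by move=> hM; apply/CrealP; rewrite -hermitian_entry. Qed.

Lemma hermitian_pencil n k (As : 'I_n -> 'M[C]_k) x :
  (forall j, hermitian (As j)) -> x \is a realmx -> hermitian (pencil As x).
Proof.
move=> hA /mxOverP xR; apply/matrixP => i j; rewrite !mxE !pencil_entry rmorph_sum.
apply: eq_bigr => l _; rewrite rmorphM /= (hermitian_entry _ _ (hA l)).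
by congr (_ * _); apply/esym/CrealP.
Qed.

(** Allows a representation to be given as a linear matrix-valued map; its coefficients are the
    values at the basis vectors. *)
Lemma has_mhdr_of_linear n k (f : 'cV[C]_n -> C) (L : 'cV[C]_n -> 'M[C]_k) :
  linear L -> (forall x, x \is a realmx -> hermitian (L x)) ->
  (forall x, x \is a realmx -> f x = \det (1%:M + L x)) ->
  has_mhdr_of_size f k.
Proof.
move=> linL hL hf; exists (fun j => L (delta_mx j 0)); split.
  by move=> j; apply: hL; exact: delta_mx_real.
move=> x xR; rewrite hf //; congr (\det (_ + _)).
pose L' : {linear 'cV[C]_n -> 'M[C]_k} :=
  HB.pack L (GRing.isLinear.Build C _ _ _ L linL).
rewrite -[L]/(L' : _ -> _) {1}[x]matrix_sum_delta linear_sum.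
by apply: eq_bigr => i _; rewrite big_ord1 linearZ.
Qed.

Lemma nsd_psd n (A : 'M[C]_n) v : nsd A -> v \is a realmx -> 0 <= bform (- A) v v.
Proof. by move=> hA vR; rewrite bformN oppr_ge0 hA. Qed.

(* Schur complement: [1 + b^T x - |B x|^2] is the determinant of [[1 + b^T x, (B x)^T], [B x, 1]]. *)
Lemma nsd_has_mhdr n (A : 'M[C]_n) b : A \is a realmx -> A^T = A ->
  b \is a realmx -> nsd A -> has_mhdr_of_size (quadf A b) (1 + n).
Proof.
move=> AR AS bR Ansd.
have [||v vR||B BR BE] := @psd_gram C n (- A) n.
- exact: oppmx_real.
- by rewrite linearN /= AS.
- exact: nsd_psd.
- exact: rank_leq_row.
pose L (x : 'cV[C]_n) : 'M[C]_(1 + n) := block_mx (b^T *m x) (B *m x)^T (B *m x) 0.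
apply: (@has_mhdr_of_linear _ _ _ L).
- move=> a u v; rewrite /L scale_block_mx add_block_mx scaler0 addr0.
  by rewrite !mulmxDr -!scalemxAr linearD linearZ.
- move=> x xR; rewrite /hermitian /L tr_block_mx map_block_mx trmxK trmx0.
  rewrite (map_mx0 Num.conj) !realmxC ?trmx_real ?mxOverM ?trmx_real //.
  by congr block_mx; apply/matrixP => i j; rewrite !ord1 mxE.
move=> x xR; rewrite /L scalar_mx_block add_block_mx addr0 !add0r.
rewrite det_schur det_mx11.
have : ((B *m x)^T *m (B *m x)) 0 0 = - bform A x x.
  by rewrite -bform_gram -BE bformN.
rewrite quadfE; move: (_ *m (B *m x)) (b^T *m x) => q p qE.
by rewrite !mxE qE eqxx mulr1n opprK; ring.
Qed.

Definition mx2 (a b c d : C) : 'M[C]_2 :=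
  \matrix_(i, j) if i == 0 then if j == 0 then a else b else if j == 0 then c else d.

Lemma hermitian_mx2 (a b c d : C) : a \is Num.real -> d \is Num.real ->
  c = Num.conj b -> hermitian (mx2 a b c d).
Proof.
move=> aR dR ->; apply/matrixP => i j; rewrite !mxE.
by case: (i == 0); case: (j == 0); rewrite ?conjCK //; apply/esym/CrealP.
Qed.

Lemma rank3_has_mhdr n (A : 'M[C]_n) b : A \is a realmx -> A^T = A ->
  b \is a realmx -> nsd (A - 4^-1 *: (b *m b^T)) ->
  (\rank (A - 4^-1 *: (b *m b^T))%R <= 3)%N -> has_mhdr_of_size (quadf A b) 2.
Proof.
set S := A - _ => AR AS bR Snsd rkS.
have r4 : 4^-1 \is @Num.real C by rewrite rpredV realn.
have [||v vR||B BR BE] := @psd_gram C n (- S) 3.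
- rewrite oppmx_real // realmxD // oppmx_real // mxOverZ // mxOverM //.
  exact: trmx_real.
- by rewrite linearN linearB linearZ /= trmx_mul trmxK AS.
- exact: nsd_psd.
- by rewrite (eqmx_opp S).
pose y (x : 'cV[C]_n) (i : 'I_3) := (B *m x) i 0.
pose p (x : 'cV[C]_n) := 2^-1 * (b^T *m x) 0 0.
(* A combination of the identity and the three Pauli matrices, with coefficients [p], [y1], [- y2],
   [y0]; its traceless part has determinant minus the sum of the three squares. *)
pose L x := mx2 (p x + y x 0) (y x 1 + 'i * y x 2%:R) (y x 1 - 'i * y x 2%:R) (p x - y x 0).
have yR x i : x \is a realmx -> y x i \is Num.real.
  by move=> xR; apply: (mxOverP (mxOverM BR xR)).
have pR x : x \is a realmx -> p x \is Num.real.
  move=> xR; rewrite rpredM ?rpredV ?realn //.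
  exact: (mxOverP (mxOverM (trmx_real bR) xR)).
apply: (@has_mhdr_of_linear _ _ _ L).
- move=> a u v; apply/matrixP => i j.
  have yE k : y (a *: u + v) k = a * y u k + y v k.
    by rewrite /y mulmxDr -scalemxAr mxE mxE.
  have pE : p (a *: u + v) = a * p u + p v.
    by rewrite /p mulmxDr -scalemxAr mxE mxE; ring.
  rewrite 5!mxE !yE pE; case: (i == 0); case: (j == 0); ring.
- move=> x xR; apply: hermitian_mx2.
  + by rewrite rpredD ?pR ?yR.
  + by rewrite rpredB ?pR ?yR.
  rewrite rmorphD rmorphM /= conjCi; have /CrealP-> := yR x 1 xR.
  by have /CrealP-> := yR x 2%:R xR; rewrite mulNr.
move=> x xR; rewrite det_mx2 !mxE /=.
have E : y x 0 ^+ 2 + y x 1 ^+ 2 + y x 2%:R ^+ 2 = 4^-1 * (b^T *m x) 0 0 ^+ 2 - bform A x x.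
  transitivity (- bform S x x); last by rewrite bformB bformZ bform_outer opprB.
  by rewrite -bformN BE bform_gram dot3 -!expr2.
have iE := sqrCi C.
rewrite quadfE; have -> : bform A x x = 4^-1 * (b^T *m x) 0 0 ^+ 2 - (y x 0 ^+ 2 + y x 1 ^+ 2 + y x 2%:R ^+ 2).
  by rewrite E; ring.
rewrite /p !mulr1n !mulr0n !add0r.
transitivity ((1 + (b^T *m x) 0 0 / 2) ^+ 2 - y x 0 ^+ 2 - (y x 1 ^+ 2 - 'i ^+ 2 * y x 2%:R ^+ 2)).
  by rewrite iE; field.
by field.
Qed.

End Representations.

(** * Necessity of (2) at size 2; spectral normal form of a direction *)

Section Converse.
Local Open Scope sesquilinear_scope.
Variable C : numClosedFieldType.
Notation realmx := (mxOver (@Num.real C)).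

(** Comparing [f] at [x] and [- x] separates degrees: [b^T x] is the trace of the pencil and
    [x^T A x] its determinant. Hence [- S] is a quarter of the squared trace minus the determinant,
    a nonnegative form in three linear forms. *)
Lemma mhdr2_sound n (A : 'M[C]_n) b : A^T = A ->
  has_mhdr_of_size (quadf A b) 2 ->
  nsd (A - 4^-1 *: (b *m b^T)) /\ (\rank (A - 4^-1 *: (b *m b^T))%R <= 3)%N.
Proof.
move=> AS [As [hA hf]]; set S := A - _.
have SE x : x \is a realmx -> let M := pencil As x in
    bform S x x = - (4^-1 * (M 0 0 - M 1 1) ^+ 2 + M 0 1 * M 1 0).
  move=> xR M.
  have := hf _ (oppmx_real xR); rewrite -/(pencil As (- x)) linearN /= -/M.
  have := hf _ xR; rewrite -/(pencil As x) -/M !det1D_mx2 !quadfE ![(- M) _ _]mxE.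
  have -> : bform A (- x) (- x) = bform A x x.
    by rewrite -scaleN1r bformZl bformZr mulrA mulrNN !mul1r.
  have -> : (b^T *m - x) 0 0 = - (b^T *m x) 0 0 by rewrite mulmxN mxE.
  rewrite /S bformB bformZ bform_outer.
  move: (bform A x x) ((b^T *m x) 0 0) (M 0 0) (M 0 1) (M 1 0) (M 1 1) => q l m00 m01 m10 m11.
  move=> E1 E2.
  have lE : l = m00 + m11.
    apply: (@mulfI _ 2); first by rewrite pnatr_eq0.
    transitivity ((q + l + 1) - (q - l + 1)); first by ring.
    by rewrite E1 E2; ring.
  have qE : q = m00 * m11 - m01 * m10.
    apply: (@mulfI _ 2); first by rewrite pnatr_eq0.
    transitivity ((q + l + 1) + (q - l + 1) - 2); first by ring.
    by rewrite E1 E2; ring.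
  by rewrite lE qE; field.
split.
  move=> x xR; rewrite -/(bform S x x) SE // oppr_le0 addr_ge0 //.
    rewrite mulr_ge0 ?invr_ge0 ?ler0n // real_exprn_even_ge0 //.
    by rewrite rpredB // hermitian_diag_real //; apply: hermitian_pencil.
  by rewrite (hermitian_entry 0 1 (hermitian_pencil hA xR)) mul_conjC_ge0.
(* The three forms are the diagonal difference and the two off-diagonal entries. They may be
   non-real, which is harmless for a rank bound over [C]. *)
pose c (i : 'I_3) (M : 'M[C]_2) :=
  if i == 0 then M 0 0 - M 1 1 else if i == 1 then M 0 1 else M 1 0.
pose N : 'M[C]_(3, n) := \matrix_(i, j) c i (As j).
have NE x i : (N *m x) i 0 = c i (pencil As x).
  rewrite mxE /c !pencil_entry -sumrB.
  by case: ifP => i0; last case: ifP => i1; apply: eq_bigr => j _;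
     rewrite mxE /c i0 ?i1 // mulrBl.
(* Matrix of the quadratic form [u ^+ 2 / 4 + v * w], so that [- S] factors through dimension 3. *)
pose J : 'M[C]_3 := \matrix_(i, j)
  if (i == 0) && (j == 0) then 4^-1 else if (i != 0) && (j != 0) && (i != j) then 2^-1 else 0.
suff -> : S = - (N^T *m (J *m N)).
  by rewrite (eqmx_opp _) (leq_trans (mxrankM_maxl _ _)) // rank_leq_col.
apply: sym_bform_inj.
- by rewrite /S linearB linearZ /= trmx_mul trmxK AS.
- rewrite linearN /= !trmx_mul trmxK mulmxA.
  suff -> : J^T = J by [].
  by apply/matrixP => i j; rewrite !mxE andbC [(j != 0) && _]andbC [j == i]eq_sym.
move=> x xR; rewrite SE // bformN; congr (- _).
rewrite /bform.
have -> : x^T *m (N^T *m (J *m N)) *m x = (N *m x)^T *m (J *m (N *m x)).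
  by rewrite trmx_mul !mulmxA.
have JE i : (J *m (N *m x)) i 0 = J i 0 * (N *m x) 0 0 + J i 1 * (N *m x) 1 0 + J i 2%:R * (N *m x) 2%:R 0.
  have := dot3 (row i J)^T (N *m x); rewrite trmxK -row_mul [row i _ 0 0]mxE => ->.
  by rewrite ![(row i J)^T _ _]mxE ![row i J _ _]mxE.
rewrite dot3 !JE !NE !mxE /c /=.
by field.
Qed.

Lemma hermitian_spectral k (M : 'M[C]_k) : hermitian M ->
  exists U : 'M[C]_k, exists d : 'rV[C]_k,
    [/\ U *m U^t* = 1%:M, d \is a realmx & U *m M *m U^t* = diag_mx d].
Proof.
move=> hM; have hs : M \is hermsymmx.
  apply/is_hermitianmxP; rewrite expr0 scale1r.
  by apply/matrixP => i j; rewrite !mxE; apply: hermitian_entry.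
exists (spectralmx M), (spectral_diag M).
have U1 := unitarymxP (spectral_unitarymx M).
split=> //; first exact: hermitian_spectral_diag_real.
have /orthomx_spectralP E := hermitian_normalmx hs.
rewrite {2}E invmx_unitary ?spectral_unitarymx //.
by rewrite !mulmxA U1 mul1mx -mulmxA U1 mulmx1.
Qed.

Lemma det_unitary_conj k (U M : 'M[C]_k) : U *m U^t* = 1%:M ->
  \det (1%:M + U *m M *m U^t*) = \det (1%:M + M).
Proof.
move=> hU; have -> : 1%:M + U *m M *m U^t* = U *m (1%:M + M) *m U^t*.
  by rewrite mulmxDr mulmxDl mulmx1 hU.
by rewrite !det_mulmx mulrAC -det_mulmx hU det1 mul1r.
Qed.

Lemma det1D_diag k (d : 'rV[C]_k) : \det (1%:M + diag_mx d) = \prod_i (1 + d 0 i).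
Proof.
rewrite -[1%:M]diag_const_mx -linearD /= det_diag.
by apply: eq_bigr => i _; rewrite !mxE.
Qed.

(** A nonzero eigenvalue [a], which is real, would make the determinant vanish at [s = - a^-1]. *)
Lemma hermitian_det1_eq0 k (M : 'M[C]_k) : hermitian M ->
  (forall s, s \is Num.real -> \det (1%:M + s *: M) = 1) -> M = 0.
Proof.
move=> hM H; have [U [d [hU dR dE]]] := hermitian_spectral hM.
suff d0 : d = 0.
  have hU' := mulmx1C hU.
  have -> : M = U^t* *m (U *m M *m U^t*) *m U.
    by rewrite !mulmxA hU' mul1mx -mulmxA hU' mulmx1.
  by rewrite dE d0 linear0 mulmx0 mul0mx.
apply/rowP => i; rewrite mxE; apply/eqP/negPn/negP => di.
have sR : - (d 0 i)^-1 \is Num.real by rewrite rpredN rpredV (mxOverP dR).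
have := H _ sR; rewrite -(det_unitary_conj _ hU) -scalemxAr -scalemxAl dE.
rewrite -linearZ /= det1D_diag (bigD1 i) //= mxE mulNr mulVf // subrr mul0r.
by move/eqP; rewrite eq_sym oner_eq0.
Qed.

(** The sample points are real, where the determinantal identities hold, and nonzero, so that they
    can be inverted in [det_corner]. *)
Lemma poly_eq_nat (p q : {poly C}) :
  (forall m, p.[m.+1%:R] = q.[m.+1%:R]) -> p = q.
Proof.
move=> H; apply/eqP; rewrite -subr_eq0; apply/negPn/negP => pq0.
have := @max_poly_roots _ (p - q) [seq m.+1%:R | m <- iota 0 (size (p - q))] pq0.
rewrite size_map size_iota ltnn => h; suff : false by [].
apply: h.
  by apply/allP => _ /mapP[m _ ->]; rewrite /root hornerD hornerN H subrr.
rewrite map_inj_uniq ?iota_uniq // => i j /eqP.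
by rewrite eqr_nat => /eqP[].
Qed.

(* Both sides are polynomials in [t]; compare degrees. *)
Lemma card_nonzero_quadratic k (d : 'rV[C]_k) (c1 c2 : C) : c2 != 0 ->
  (forall t, t \is Num.real -> \det (1%:M + t *: diag_mx d) = 1 + t * c1 + t ^+ 2 * c2) ->
  #|[set i | d 0 i != 0]| = 2%N.
Proof.
move=> c20 H.
pose p := \prod_i (1 + d 0 i *: 'X).
have pE : p = Poly [:: 1; c1; c2].
  apply: poly_eq_nat => m; rewrite /p horner_prod.
  have := H m.+1%:R (realn _ _); rewrite -linearZ /= det1D_diag => E.
  transitivity (\prod_i (1 + (m.+1%:R *: d) 0 i)).
    by apply: eq_bigr => i _; rewrite !hornerE mxE mulrC.
  by rewrite E !hornerE; ring.
have szp : size p = 3%N by rewrite pE (@PolyK _ 0) //= c20.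
have szf i : size (1 + d 0 i *: 'X) = (d 0 i != 0).+1.
  have [->|di] := eqVneq; first by rewrite scale0r addr0 size_poly1.
  by rewrite addrC size_polyDl ?size_poly1 size_scale ?size_polyX.
move: szp; rewrite /p size_prod => [|i _]; last by rewrite -size_poly_eq0 szf.
under eq_bigr do rewrite szf -addn1.
rewrite big_split /= sum1_card -addSn addnK => -[<-].
by rewrite -sum1_card big_mkcond /=; apply: eq_bigr => i _; rewrite inE; case: eqP.
Qed.

Lemma card_spectral k (M U : 'M[C]_k) (d : 'rV[C]_k) (c1 c2 : C) :
  U *m U^t* = 1%:M -> U *m M *m U^t* = diag_mx d -> c2 != 0 ->
  (forall t, t \is Num.real -> \det (1%:M + t *: M) = 1 + t * c1 + t ^+ 2 * c2) ->
  #|[set i | d 0 i != 0]| = 2%N.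
Proof.
move=> hU dE c20 H; apply: (@card_nonzero_quadratic _ _ c1 c2 c20) => t tR.
by rewrite -H // -dE scalemxAl scalemxAr det_unitary_conj.
Qed.

Lemma perm_pair (T : finType) (a b x y : T) : a != b -> x != y ->
  exists s : {perm T}, s a = x /\ s b = y.
Proof.
(* The left factor acts first: it sends [b] to the preimage of [y] under [tperm a x] and fixes [a];
   then [tperm a x] puts both in place. *)
move=> ab xy; exists (tperm b (tperm a x y) * tperm a x)%g.
split; rewrite permM; last by rewrite tpermL tpermK.
rewrite [tperm b _ a]tpermD ?tpermL // 1?eq_sym //.
by apply: contra_neq xy => E; rewrite -[y](tpermK a x) -E tpermL.
Qed.

(** Exactly two eigenvalues are nonzero; permuting the rows of the diagonalizing unitary matrix
    moves them to the first two positions. *)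
Lemma hermitian_rank2_form m (M : 'M[C]_(2 + m)) (c1 c2 : C) : hermitian M -> c2 != 0 ->
  (forall t, t \is Num.real -> \det (1%:M + t *: M) = 1 + t * c1 + t ^+ 2 * c2) ->
  exists U : 'M[C]_(2 + m), exists d : 'rV[C]_2,
    [/\ U *m U^t* = 1%:M, d \is a realmx &
        U *m M *m U^t* = block_mx (diag_mx d) 0 0 0].
Proof.
move=> hM c20 H; have [U [d [hU dR dE]]] := hermitian_spectral hM.
have /eqP := card_spectral hU dE c20 H.
case/cards2P => x [y [xy dxy]].
have [s [s0 s1]] := @perm_pair 'I_(2 + m) 0 1 _ _ isT xy.
have rowsubC : (rowsub s U)^t* = colsub s (U^t*).
  by apply/matrixP => i j; rewrite !mxE.
exists (rowsub s U), (\row_i d 0 (s (lshift m i))); split.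
- rewrite rowsubC -mxsub_mul hU; apply/matrixP => i j.
  by rewrite !mxE (inj_eq perm_inj).
- by apply/mxOverP => i j; rewrite mxE (mxOverP dR).
rewrite mul_rowsub_mx rowsubC -mxsub_mul dE.
have d0 i : d 0 (s (rshift 2 i)) = 0.
  have : s (rshift 2 i) \notin [set i | d 0 i != 0].
    by rewrite dxy !inE -s0 -s1 !(inj_eq perm_inj) -!val_eqE.
  by rewrite inE negbK => /eqP.
rewrite -[LHS]submxK; congr block_mx; apply/matrixP => i j;
  by rewrite !mxE (inj_eq perm_inj) ?(inj_eq (@lshift_inj _ _)) ?eq_lrshift ?eq_rlshift ?d0 ?mul0rn.
Qed.
End Converse.

(** * Reduction of a representation to size 2 *)

Section Reduction.
Local Open Scope sesquilinear_scope.
Variable C : numClosedFieldType.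
Notation realmx := (mxOver (@Num.real C)).

Lemma quadf_line n (A : 'M[C]_n) b x y t : A^T = A ->
  quadf A b (t *: x + y) =
    t ^+ 2 * bform A x x + t * (2 * bform A x y + (b^T *m x) 0 0) + quadf A b y.
Proof.
move=> AS; rewrite !quadfE !bformDl !bformDr !bformZl !bformZr (bform_sym y x AS).
have -> : (b^T *m (t *: x + y)) 0 0 = t * (b^T *m x) 0 0 + (b^T *m y) 0 0.
  by rewrite mulmxDr -scalemxAr mxE; congr (_ + _); rewrite mxE.
by move: (bform A x x) (bform A x y) (bform A y y) => *; ring.
Qed.

Lemma quadf0 n (A : 'M[C]_n) b : quadf A b 0 = 1.
Proof. by rewrite quadfE /bform !mulmx0 !mxE !add0r. Qed.

Lemma conj_trmx_quad m n (Q : 'M[C]_(m, n)) i :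
  (Q *m Q^t*) i i = \sum_j `|Q i j| ^+ 2.
Proof. by rewrite mxE; apply: eq_bigr => j _; rewrite !mxE normCK. Qed.

Lemma conj_trmx_quad_ge0 m n (Q : 'M[C]_(m, n)) i : 0 <= (Q *m Q^t*) i i.
Proof. by rewrite conj_trmx_quad sumr_ge0 // => j _; rewrite exprn_ge0. Qed.

Lemma conj_trmx_quad_eq0 m n (Q : 'M[C]_(m, n)) :
  (forall i, (Q *m Q^t*) i i = 0) -> Q = 0.
Proof.
move=> H; apply/matrixP => i j; rewrite mxE; apply/eqP.
have := H i; rewrite conj_trmx_quad => /eqP.
rewrite psumr_eq0 => [/allP/(_ j)|k _]; last by rewrite exprn_ge0.
by rewrite mem_index_enum sqrf_eq0 normr_eq0; apply.
Qed.

(** Makes the determinant a polynomial in [u], so that its value at [u = 0] follows from values at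
    nonzero [u]. *)
Lemma det_pencil_poly k (E F : 'M[C]_k) :
  exists p : {poly C}, forall u, p.[u] = \det (E + u *: F).
Proof.
exists (\det (map_mx polyC E + 'X *: map_mx polyC F)) => u.
rewrite -horner_evalE -det_map_mx; congr (\det _).
by apply/matrixP => i j; rewrite !mxE /= horner_evalE !hornerE.
Qed.

(** * Pencils already diagonal, of rank 2, in a direction where [A] is positive *)

Section Normal.
Variables (n m : nat) (A : 'M[C]_n) (b x0 : 'cV[C]_n).
Variables (As : 'I_n -> 'M[C]_(2 + m)) (d : 'rV[C]_2).
Hypothesis AS : A^T = A.
Hypothesis As_herm : forall j, hermitian (As j).
Hypothesis detE : forall x, x \is a realmx -> quadf A b x = \det (1%:M + pencil As x).
Hypothesis x0R : x0 \is a realmx.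
Hypothesis dR : d \is a realmx.
Hypothesis As_x0 : pencil As x0 = block_mx (diag_mx d) 0 0 0.
Hypothesis Ax0 : 0 < bform A x0 x0.

Let N := pencil As.
Let P x := ulsubmx (N x).
Let Q x := ursubmx (N x).
Let Q' x := dlsubmx (N x).
Let R x := drsubmx (N x).

Let NE x : N x = block_mx (P x) (Q x) (Q' x) (R x).
Proof. by rewrite submxK. Qed.

Let ND y z : N (y + z) = N y + N z.
Proof. by rewrite /N linearD. Qed.

Let NZ a y : N (a *: y) = a *: N y.
Proof. by rewrite /N linearZ. Qed.

Let Q'E x : x \is a realmx -> Q' x = (Q x)^t*.
Proof.
move=> xR; have hN : hermitian (N x) by apply: hermitian_pencil.
by apply/matrixP => i j; rewrite !mxE; apply: hermitian_entry.
Qed.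

(* Read the leading coefficient in [t] of [quadf A b (t *: x0 + x)], with [u = t^-1] so that it becomes the value at [u = 0]. *)
Lemma det_corner x : x \is a realmx ->
  \det (diag_mx d) * \det (1%:M + R x) = bform A x0 x0.
Proof.
move=> xR.
(* [E + u *: F] is [1 + N (u^-1 *: x0 + x)] with its first two rows multiplied by [u]; the other
   rows do not see [x0]. *)
pose E := block_mx (diag_mx d) 0 (Q' x) (1%:M + R x).
pose F : 'M[C]_(2 + m) := block_mx (1%:M + P x) (Q x) 0 0.
have [p pE] := det_pencil_poly E F.
(* Expansion of [u ^+ 2 * quadf A b (u^-1 *: x0 + x)] by [quadf_line]; two scaled rows account for
   the factor [u ^+ 2]. *)
pose q : {poly C} := (bform A x0 x0)%:P + (2 * bform A x0 x + (b^T *m x0) 0 0) *: 'X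
  + quadf A b x *: 'X^2.
suff pq : p = q.
  rewrite -(det_lblock _ (Q' x)) -/E -[E]addr0 -[0 in LHS](scale0r F) -pE pq.
  by rewrite /q !hornerD !hornerZ hornerC hornerX hornerXn; ring.
apply: poly_eq_nat => k; set u := k.+1%:R.
have u0 : u != 0 by rewrite pnatr_eq0.
have uR : u \is Num.real by rewrite realn.
have yR : u^-1 *: x0 + x \is a realmx by rewrite realmxD // mxOverZ // rpredV.
rewrite pE.
have -> : E + u *: F = block_mx u%:M 0 0 1%:M *m (1%:M + N (u^-1 *: x0 + x)).
  rewrite ND NZ [N x0]As_x0 (NE x) /E /F !scale_block_mx scalar_mx_block.
  rewrite !add_block_mx mulmx_block.
  rewrite !(mul0mx, mul1mx, scaler0, addr0, add0r) !mul_scalar_mx.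
  congr block_mx.
  by rewrite [in RHS]addrCA [in RHS]scalerDr scalerA divff // scale1r.
rewrite det_mulmx det_lblock det1 mulr1 det_scalar -detE // quadf_line // /q.
rewrite !hornerD !hornerZ hornerC hornerX hornerXn.
clearbody u; field; exact: u0.
Qed.

(** [det_corner] at [0] evaluates the determinant of [diag_mx d]; cancelling it at [s *: x] leaves
    [\det (1 + s *: R x) = 1] for every real [s]. *)
Lemma corner_eq0 x : x \is a realmx -> R x = 0.
Proof.
move=> xR; have R0 : R 0 = 0 by rewrite /R /N /drsubmx !linear0.
have a0 : bform A x0 x0 != 0 by rewrite gt_eqF.
have dd : \det (diag_mx d) = bform A x0 x0.
  rewrite -(det_corner (x := 0)) ?R0 ?addr0 ?det1 ?mulr1 //.
  by apply/mxOverP => i j; rewrite mxE.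
apply: hermitian_det1_eq0 => [|s sR].
  have hN : hermitian (N x) by apply: hermitian_pencil.
  by apply/matrixP => i j; rewrite !mxE; apply: hermitian_entry.
have := det_corner (mxOverZ sR xR); rewrite dd /R NZ /drsubmx !linearZ /=.
by move/(canRL (mulKf a0)); rewrite mulVf.
Qed.

Lemma det_corner0 : d 0 0 * d 0 1 = bform A x0 x0.
Proof.
rewrite -(det_corner x0R) corner_eq0 // addr0 det1 mulr1 det_diag.
rewrite !big_ord_recl big_ord0 mulr1; congr (_ * d 0 _); exact/val_inj.
Qed.

Lemma quadf_schur x : x \is a realmx ->
  quadf A b x = \det (1%:M + (P x - Q x *m Q' x)).
Proof.
move=> xR; rewrite detE // [pencil _ _]NE corner_eq0 // scalar_mx_block.
by rewrite add_block_mx !add0r addr0 det_schur addrA.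
Qed.

(* The mixed second difference of [quadf A b] along [x], between base points [x0] and [0], vanishes; on the determinant side only the terms in [d] times [Q x *m Q' x] survive. *)
Lemma side_diag x : x \is a realmx ->
  d 0 0 * (Q x *m Q' x) 1 1 + d 0 1 * (Q x *m Q' x) 0 0 = 0.
Proof.
move=> xR; have NxR := oppmx_real xR.
have PN y : P (- y) = - P y by rewrite /P /N /ulsubmx !linearN.
have PD y z : P (y + z) = P y + P z by rewrite /P /N /ulsubmx !linearD.
have GN y : Q (- y) *m Q' (- y) = Q y *m Q' y.
  have QN : Q (- y) = - Q y by rewrite /Q /N /ursubmx !linearN.
  have Q'N : Q' (- y) = - Q' y by rewrite /Q' /N /dlsubmx !linearN.
  by rewrite QN Q'N mulmxN mulNmx opprK.
have P0 : P x0 = diag_mx d by rewrite /P /N As_x0 block_mxKul.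
(* [N x0] lives in the upper left block, so a shift by [x0] changes only [P]. *)
have G0 y : Q (x0 + y) *m Q' (x0 + y) = Q y *m Q' y.
  have -> : Q (x0 + y) = Q y.
    by rewrite /Q ND [N x0]As_x0 (NE y) add_block_mx !block_mxKur add0r.
  suff -> : Q' (x0 + y) = Q' y by [].
  by rewrite /Q' ND [N x0]As_x0 (NE y) add_block_mx !block_mxKdl add0r.
have q1 : quadf A b (x0 + x) + quadf A b (x0 - x) - 2 * quadf A b x0
   = quadf A b x + quadf A b (- x) - 2.
  have bD y z : (b^T *m (y + z)) 0 0 = (b^T *m y) 0 0 + (b^T *m z) 0 0.
    by rewrite mulmxDr mxE.
  have bN : (b^T *m - x) 0 0 = - (b^T *m x) 0 0 by rewrite mulmxN mxE.
  rewrite -[- x]scaleN1r !quadfE !(bformDl, bformDr, bformZl, bformZr) scaleN1r.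
  by rewrite !bD bN; ring.
move: q1; rewrite !quadf_schur ?realmxD // !G0 !PD !GN PN P0.
have G00 : Q x0 *m Q' x0 = 0 by rewrite -[x0]addr0 G0 /Q /N /ursubmx !linear0 mul0mx.
rewrite G00 subr0 !det1D_mx2.
move: (Q x *m Q' x) (P x) => g p; rewrite !mxE /= !mulr1n !mulr0n => /eqP.
rewrite -subr_eq0 => E; apply/eqP.
have : (d 0 0 * g 1 1 + d 0 1 * g 0 0) * -2 == 0.
  by apply: etrans E; congr (_ == 0); ring.
by rewrite mulf_eq0 oppr_eq0 pnatr_eq0 orbF.
Qed.

(** The entries of [d] have a positive product, hence the same sign, so both terms of [side_diag]
    vanish; each is a multiple of the squared norm of a row of [Q x]. *)
Lemma side_eq0 x : x \is a realmx -> Q x = 0.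
Proof.
move=> xR; have := side_diag xR; rewrite Q'E //.
set g0 := (_ *m _) 0 0; set g1 := (_ *m _) 1 1 => g.
have g00 : 0 <= g0 by apply: conj_trmx_quad_ge0.
have g10 : 0 <= g1 by apply: conj_trmx_quad_ge0.
(* Multiplying by [u] turns the relation into [u ^+ 2 * p + (u * v) * q = 0], with nonnegative terms
   whatever the common sign of [u] and [v]. *)
have pos u v p q : u \is Num.real -> u * v = bform A x0 x0 -> 0 <= p -> 0 <= q ->
    u * p + v * q = 0 -> p = 0.
  move=> uR uv p0 q0 /(congr1 ( *%R u)) /eqP.
  have u0 : u != 0 by apply: contraTneq Ax0 => u0; rewrite -uv u0 mul0r ltxx.
  have u2 : 0 <= u ^+ 2 by rewrite real_exprn_even_ge0.
  rewrite mulr0 mulrDr !mulrA uv -expr2 paddr_eq0 ?(mulr_ge0 u2 p0) ?(mulr_ge0 (ltW Ax0) q0) //.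
  by rewrite mulf_eq0 expf_eq0 (negPf u0) /= => /andP[/eqP].
have d01 := det_corner0.
apply: conj_trmx_quad_eq0 => i.
have [->|->] : i = 0 \/ i = 1 by case: i => [[|[|//]] ?]; [left | right]; apply/val_inj.
  apply: (pos (d 0 1) (d 0 0) _ g1) => //; first exact: (mxOverP dR).
    by rewrite mulrC.
  by rewrite addrC.
by apply: (pos (d 0 0) (d 0 1) _ g0) => //; exact: (mxOverP dR).
Qed.

Lemma normal_mhdr2 : has_mhdr_of_size (quadf A b) 2.
Proof.
apply: (@has_mhdr_of_linear _ _ _ _ P).
- by move=> a u v; rewrite /P /N /ulsubmx !linearP.
- move=> x xR; have hN : hermitian (N x) by apply: hermitian_pencil.
  by apply/matrixP => i j; rewrite !mxE; apply: hermitian_entry.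
by move=> x xR; rewrite quadf_schur // side_eq0 // mul0mx subr0.
Qed.
End Normal.

Lemma mhdr_reduce n k (A : 'M[C]_n) b x0 : A^T = A -> x0 \is a realmx ->
  0 < bform A x0 x0 -> has_mhdr_of_size (quadf A b) k ->
  has_mhdr_of_size (quadf A b) 2.
Proof.
move=> AS x0R Ax0 [As [hA hf]].
have line t : t \is Num.real -> \det (1%:M + t *: pencil As x0) =
    1 + t * (b^T *m x0) 0 0 + t ^+ 2 * bform A x0 x0.
  move=> tR; rewrite -linearZ /= -hf ?mxOverZ // -[_ *: x0]addr0 quadf_line //.
  have -> : bform A x0 0 = 0 by rewrite /bform mulmx0 mxE.
  by rewrite quadf0 mulr0 add0r; ring.
have A0 : bform A x0 x0 != 0 by rewrite gt_eqF.
have hM := hermitian_pencil hA x0R.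
(* Two nonzero eigenvalues need at least two indices; afterwards [k] can be written [2 + m]. *)
have k2 : (1 < k)%N.
  have [U [d [hU _ dE]]] := hermitian_spectral hM.
  by rewrite -(card_spectral hU dE A0 line) -[leqRHS]card_ord max_card.
case: k k2 As hA hf line hM => [|[|m]] // _ As hA hf line hM.
have [U [d [hU dR UE]]] := @hermitian_rank2_form C m _ _ _ hM A0 line.
(* One unitary conjugation of all coefficients keeps them Hermitian and preserves the determinant,
   while bringing [x0] to normal form. *)
pose As' j := U *m As j *m U^t*.
have As'E x : pencil As' x = U *m pencil As x *m U^t*.
  rewrite /pencil mulmx_sumr mulmx_suml; apply: eq_bigr => j _.
  by rewrite -scalemxAr -scalemxAl.
apply: (@normal_mhdr2 n m A b x0 As' d) => // [j|x xR|].
- rewrite /hermitian /As' !map_mxM -[map_mx _ (As j)]hA !trmx_mul !map_trmx.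
  by rewrite mulmxA -map_mx_comp (map_mx_id (@conjCK _)) trmxK.
- by rewrite As'E det_unitary_conj // hf.
by rewrite As'E UE.
Qed.
End Reduction.

(** * The equivalence and the size 2 refinement *)

Theorem mainTheorem8 (C : numClosedFieldType) (n : nat)
    (A : 'M[C]_n) (b : 'cV[C]_n)
    (hAreal : A \is a mxOver Num.real) (hAsym : A^T = A)
    (hbreal : b \is a mxOver Num.real) :
  ((exists k : nat, (0 < k)%N /\ has_mhdr_of_size (quadf A b) k) <->
   (nsd A \/ (nsd (A - 4^-1 *: (b *m b^T)) /\ (\rank (A - 4^-1 *: (b *m b^T))%R <= 3)%N)))
  /\
  (~ nsd A -> (exists k : nat, (0 < k)%N /\ has_mhdr_of_size (quadf A b) k) ->
   has_mhdr_of_size (quadf A b) 2).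
Proof.
have red : ~ nsd A -> (exists k, (0 < k)%N /\ has_mhdr_of_size (quadf A b) k) ->
    has_mhdr_of_size (quadf A b) 2.
  move=> Anot [k [_ hk]].
  (* Failure of [nsd A] yields a real [x0] where the form is not nonpositive; being real, its value
     is then positive. *)
  have [x0 /not_all_ex_not] := not_all_ex_not _ _ Anot.
  move=> [x0R /negP]; rewrite -/(bform A x0 x0) -real_ltNge ?real0 ?bform_real //.
  by move=> Ax0; apply: (mhdr_reduce hAsym x0R Ax0 hk).
split=> //; split.
  have [Ansd _|Anot /(red Anot) h2] := classic (nsd A); first by left.
  by right; apply: mhdr2_sound.
case=> [Ansd|[Snsd rkS]].
  by exists n.+1; split=> //; apply: nsd_has_mhdr.
by exists 2%N; split=> //; apply: rank3_has_mhdr.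
Qed.
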